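(* Let $\psi:\mathfrak h'\otimes A\to\mathbb C$ be a linear map such that for every $h\in\mathfrak h'$ the function $\psi_h:\mathbb Z^n\to\mathbb C$, $\psi_h(m_1,\dots,m_n)=\psi(h\otimes t_1^{m_1}\cdots t_n^{m_n})$, is an exp-polynomial map, and suppose that $A_\psi=\mathbb C[t_1^{\pm r_1},\dots,t_n^{\pm r_n}]$ for positive integers $r_1,\dots,r_n$ with $R=r_1\cdots r_n\ge 2$. Then for every $h\in\mathfrak h'$ $$\psi_h=P_R\sum_{\lambda\in B}p_{h,\lambda}\,\exp\lambda ,$$ where the sum over $\lambda$ is finite and each $p_{h,\lambda}:\mathbb Z^n\to\mathbb C$ is a polynomial function, i.e. of the form $p_{h,\lambda}(m_1,\dots,m_n)=\sum_{\ell}C_{h,\lambda,\ell}\,m_1^{\ell_1}\cdots m_n^{\ell_n}$, a finite sum over $\ell=(\ell_1,\dots,\ell_n)\in\mathbb Z_{\ge0}^n$ with constants $C_{h,\lambda,\ell}\in\mathbb C$ depending on $h,\lambda,\ell$.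
   Context: $\mathfrak g$ is a Kac-Moody Lie algebra over $\mathbb C$ with Cartan subalgebra $\mathfrak h$, $\mathfrak g'=[\mathfrak g,\mathfrak g]$, $\mathfrak h'=\mathfrak h\cap\mathfrak g'$, and $A=\mathbb C[t_1^{\pm1},\dots,t_n^{\pm1}]$; write $t^m=t_1^{m_1}\cdots t_n^{m_n}$ for $m\in\mathbb Z^n$. For a linear map $\psi$ on $\mathfrak h'\otimes A$, let $\overline\psi:\mathfrak h'\otimes A\to A$ be the linear map $\overline\psi(h\otimes t^m)=\psi(h\otimes t^m)t^m$, extended to an algebra homomorphism $U(\mathfrak h'\otimes A)\to A$ ($U$ denotes the universal enveloping algebra of the abelian Lie algebra $\mathfrak h'\otimes A$). $A_\psi\subseteq A$ denotes its image. A function $f:\mathbb Z^n\to\mathbb C$ is an exp-polynomial map if it is a finite sum $f(m)=\sum_{k,a}C_{k,a}m_1^{k_1}\cdots m_n^{k_n}a_1^{m_1}\cdots a_n^{m_n}$ with $k\in\mathbb Z_{\ge0}^n$, $a\in(\mathbb C^* )^n$, $C_{k,a}\in\mathbb C$. For $\lambda\in(\mathbb C^* )^n$, $\exp\lambda:\mathbb Z^n\to\mathbb C$ is the function $(\exp\lambda)(m)=\lambda_1^{m_1}\cdots\lambda_n^{m_n}$. Fix a primitive $r_i$-th root of unity $\xi_i$ for each $i$. Let $\overline\Gamma=\mathbb Z/r_1\mathbb Z\oplus\cdots\oplus\mathbb Z/r_n\mathbb Z$ act on $(\mathbb C^* )^n$ by $k\cdot\lambda=(\xi_1^{k_1}\lambda_1,\dots,\xi_n^{k_n}\lambda_n)$,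 and let $B\subset(\mathbb C^* )^n$ be a set of representatives of the orbits of this action. For $k\in\overline\Gamma$ let $T_k$ be the linear operator on exp-polynomial maps with $T_k(p\exp\lambda)=p\exp(k\cdot\lambda)$ for every polynomial function $p$ (equivalently $(T_kf)(m)=\xi_1^{k_1m_1}\cdots\xi_n^{k_nm_n}f(m)$), and let $P_R=\sum_{k\in\overline\Gamma}T_k$. *)

(* Defs.v *)
From HB Require Import structures.
From mathcomp Require Import all_boot all_order all_algebra finmap complex.
From mathcomp Require Import boolp classical_sets reals.
From mathcomp Require Import monalg.

Set Implicit Arguments.
Unset Strict Implicit.
Unset Printing Implicit Defensive.

Import Order.TTheory GRing.Theory Num.Theory.

Local Open Scope ring_scope.
Local Open Scope classical_set_scope.
Local Open Scope quotient_scope.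

Definition is_submodule (K : fieldType) (V : lmodType K) (W : set V) : Prop :=
  W 0 /\ forall (a : K) (u v : V), W u -> W v -> W (a *: u + v).

Definition is_subalgebra (K : fieldType) (A : algType K) (S : set A) : Prop :=
  [/\ is_submodule S, S 1 & forall x y : A, S x -> S y -> S (x * y)].

HB.mixin Record isLieAlgebra (K : fieldType) L of GRing.Lmodule K L := {
  lie : L -> L -> L;
  lie_linearl : forall (z : L) (a : K) (x y : L),
    lie (a *: x + y) z = a *: lie x z + lie y z;
  lie_linearr : forall (z : L) (a : K) (x y : L),
    lie z (a *: x + y) = a *: lie z x + lie z y;
  liexx : forall x : L, lie x x = 0;
  lie_jacobi : forall x y z : L,
    lie x (lie y z) + lie y (lie z x) + lie z (lie x y) = 0
}.

#[short(type="lieType")]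
HB.structure Definition LieAlgebra (K : fieldType) :=
  {L of GRing.Lmodule K L & isLieAlgebra K L}.

Definition is_lie_subalgebra (K : fieldType) (L : lieType K) (S : set L) :=
  is_submodule S /\ forall x y : L, S x -> S y -> S (lie x y).

Definition is_lie_ideal (K : fieldType) (L : lieType K) (S : set L) :=
  is_submodule S /\ forall x y : L, S y -> S (lie x y).

Definition derived (K : fieldType) (L : lieType K) : set L :=
  smallest (@is_submodule K L) [set z | exists x y : L, z = lie x y].
Arguments derived {K} L _.

Definition abelian_lie (K : fieldType) (V : lmodType K) : Type := V.

Section AbelianLie.
Variables (K : fieldType) (V : lmodType K).

HB.instance Definition _ := GRing.Lmodule.on (abelian_lie V).

Let br (x y : abelian_lie V) : abelian_lie V := 0.

Fact abelian_lie_linearl z a x y : br (a *: x + y) z = a *: br x z + br y z.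
Proof. by rewrite /br scaler0 addr0. Qed.

Fact abelian_lie_linearr z a x y : br z (a *: x + y) = a *: br z x + br z y.
Proof. by rewrite /br scaler0 addr0. Qed.

Fact abelian_liexx x : br x x = 0.
Proof. by []. Qed.

Fact abelian_lie_jacobi x y z :
  br x (br y z) + br y (br z x) + br z (br x y) = 0.
Proof. by rewrite /br !addr0. Qed.

HB.instance Definition _ := isLieAlgebra.Build K (abelian_lie V)
  abelian_lie_linearl abelian_lie_linearr abelian_liexx abelian_lie_jacobi.

End AbelianLie.

Definition is_gcm (N : nat) (M : 'M[int]_N) : Prop :=
  [/\ forall i, M i i = 2,
      forall i j, i != j -> M i j <= 0
    & forall i j, M i j = 0 -> M j i = 0].

(* The Kac-Moody algebra of a generalized Cartan matrix (V. Kac, Infinite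
   dimensional Lie algebras, 1.1-1.4): the Cartan subalgebra, embedded by
   [km_emb], carries a minimal realization of the matrix, the algebra is
   generated by it and the Chevalley generators, and no nonzero ideal meets
   it trivially, which is what dividing the algebra given by the relations by
   its largest such ideal amounts to. *)
Record kac_moody (K : fieldType) := KacMoody {
  km_alg :> lieType K;
  km_size : nat;
  km_gcm : 'M[int]_km_size;
  km_gcmP : is_gcm km_gcm;
  km_h : vectType K;
  km_emb : {linear km_h -> km_alg};
  km_emb_inj : injective km_emb;
  km_coroot : km_size.-tuple km_h;
  km_root : km_size.-tuple 'Hom(km_h, K^o);
  km_coroot_free : free km_coroot;
  km_root_free : free km_root;
  km_pairing : forall i j,
    tnth km_root j (tnth km_coroot i) = (km_gcm i j)%:~R;
  km_dim : (\dim (fullv : {vspace km_h})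
            + \rank (map_mx intr km_gcm : 'M[K]_km_size) = 2 * km_size)%N;
  km_e : 'I_km_size -> km_alg;
  km_f : 'I_km_size -> km_alg;
  km_hh : forall x y, lie (km_emb x) (km_emb y) = 0;
  km_ef : forall i j,
    lie (km_e i) (km_f j) = if i == j then km_emb (tnth km_coroot i) else 0;
  km_he : forall x i,
    lie (km_emb x) (km_e i) = (tnth km_root i x : K) *: km_e i;
  km_hf : forall x i,
    lie (km_emb x) (km_f i) = - ((tnth km_root i x : K) *: km_f i);
  km_gen : forall S : set km_alg, is_lie_subalgebra S ->
    range km_emb `<=` S -> range km_e `<=` S -> range km_f `<=` S ->
    S = setT;
  km_simple : forall I : set km_alg, is_lie_ideal I ->
    I `&` range km_emb `<=` [set 0] -> I `<=` [set 0]
}.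

Section Hprime.
Variables (K : fieldType) (g : kac_moody K).

Definition cartan : set g := range (km_emb g).

Definition hprime_pred : {pred g} := fun x => `[< (cartan `&` derived g) x >].

Fact hprime_submod : submod_closed hprime_pred.
Proof.
split=> [|a u v /asboolP[[x _ <-] du] /asboolP[[y _ <-] dv]]; apply/asboolP.
  split; first by exists 0; rewrite ?linear0.
  by move=> W [[W0 _] _].
split; first by exists (a *: x + y) => //; rewrite linearP.
by move=> W WP; apply: WP.1.2; [apply: du | apply: dv].
Qed.

HB.instance Definition _ :=
  GRing.isSubmodClosed.Build K g hprime_pred hprime_submod.

Record hprime := Hprime { hprime_val :> g; _ : hprime_val \in hprime_pred }.

HB.instance Definition _ := [isSub for hprime_val].
HB.instance Definition _ := [Choice of hprime by <:].
HB.instance Definition _ := [SubChoice_isSubLmodule of hprime by <:].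

End Hprime.

(* [V (x) W] is the vector space generated by the symbols [v (x) w] subject to
   bilinearity: formal linear expressions in these symbols, modulo the least
   congruence containing the vector space axioms and bilinearity. *)

Section Tensor.
Variables (K : fieldType) (V W : lmodType K).

Inductive tterm : Type :=
  | TPure of V & W
  | TAdd of tterm & tterm
  | TScale of K & tterm.

Inductive teq : tterm -> tterm -> Prop :=
  | teq_refl x : teq x x
  | teq_sym x y : teq x y -> teq y x
  | teq_trans y x z : teq x y -> teq y z -> teq x z
  | teq_add x x' y y' : teq x x' -> teq y y' -> teq (TAdd x y) (TAdd x' y')
  | teq_scale c x x' : teq x x' -> teq (TScale c x) (TScale c x')
  | teq_addA x y z : teq (TAdd x (TAdd y z)) (TAdd (TAdd x y) z)
  | teq_addC x y : teq (TAdd x y) (TAdd y x)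
  | teq_add0 x : teq (TAdd (TPure 0 0) x) x
  | teq_addN x : teq (TAdd (TScale (-1) x) x) (TPure 0 0)
  | teq_scaleA a b x : teq (TScale a (TScale b x)) (TScale (a * b) x)
  | teq_scale1 x : teq (TScale 1 x) x
  | teq_scaleDr a x y :
      teq (TScale a (TAdd x y)) (TAdd (TScale a x) (TScale a y))
  | teq_scaleDl a b x : teq (TScale (a + b) x) (TAdd (TScale a x) (TScale b x))
  | teq_pureDl v v' w : teq (TPure (v + v') w) (TAdd (TPure v w) (TPure v' w))
  | teq_pureDr v w w' : teq (TPure v (w + w')) (TAdd (TPure v w) (TPure v w'))
  | teq_pureZl a v w : teq (TPure (a *: v) w) (TScale a (TPure v w))
  | teq_pureZr a v w : teq (TPure v (a *: w)) (TScale a (TPure v w)).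

HB.instance Definition _ := gen_eqMixin tterm.
HB.instance Definition _ := gen_choiceMixin tterm.

Definition teqb (x y : tterm) : bool := `[< teq x y >].

Fact teqb_refl : reflexive teqb.
Proof. by move=> x; apply/asboolP; apply: teq_refl. Qed.

Fact teqb_sym : symmetric teqb.
Proof. by move=> x y; apply/asboolP/asboolP; apply: teq_sym. Qed.

Fact teqb_trans : transitive teqb.
Proof.
move=> y x z /asboolP xy /asboolP yz.
by apply/asboolP; apply: teq_trans xy yz.
Qed.

Canonical teqb_equiv := EquivRel teqb teqb_refl teqb_sym teqb_trans.

Definition tensor : Type := {eq_quot teqb}.
HB.instance Definition _ := Choice.on tensor.

Definition tensor_of (x : tterm) : tensor := \pi_({eq_quot teqb}) x.
Definition tensor_repr (x : tensor) : tterm := repr (x : {eq_quot teqb}).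

Lemma tensor_reprK : cancel tensor_repr tensor_of.
Proof. by move=> x; rewrite /tensor_of /tensor_repr reprK. Qed.

Lemma tensor_ofP x y : tensor_of x = tensor_of y <-> teq x y.
Proof.
split=> [/eqmodP/asboolP //|xy].
by apply/eqmodP/asboolP.
Qed.

Lemma repr_tensor_of x : teq (tensor_repr (tensor_of x)) x.
Proof. by apply/tensor_ofP; rewrite tensor_reprK. Qed.

(* Operations are locked, as functions, so that a failing comparison of two
   elements does not unfold them. *)
Definition tens : V -> W -> tensor := locked (fun v w => tensor_of (TPure v w)).

Definition tensor_add : tensor -> tensor -> tensor :=
  locked (fun x y => tensor_of (TAdd (tensor_repr x) (tensor_repr y))).
Definition tensor_scale : K -> tensor -> tensor :=
  locked (fun c x => tensor_of (TScale c (tensor_repr x))).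

Lemma tensE v w : tens v w = tensor_of (TPure v w).
Proof. by rewrite /tens -lock. Qed.

Lemma tensor_addE x y : tensor_add (tensor_of x) (tensor_of y) =
  tensor_of (TAdd x y).
Proof.
rewrite /tensor_add -lock.
by apply/tensor_ofP; apply: teq_add; apply: repr_tensor_of.
Qed.

Lemma tensor_scaleE c x : tensor_scale c (tensor_of x) = tensor_of (TScale c x).
Proof.
rewrite /tensor_scale -lock.
by apply/tensor_ofP; apply: teq_scale; apply: repr_tensor_of.
Qed.

Lemma tensorW (P : tensor -> Prop) :
  (forall x, P (tensor_of x)) -> forall x, P x.
Proof. by move=> h x; rewrite -(tensor_reprK x). Qed.

Fact tensor_addA : associative tensor_add.
Proof.
elim/tensorW=> x; elim/tensorW=> y; elim/tensorW=> z.
by rewrite !tensor_addE; apply/tensor_ofP; apply: teq_addA.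
Qed.

Fact tensor_addC : commutative tensor_add.
Proof.
elim/tensorW=> x; elim/tensorW=> y.
by rewrite !tensor_addE; apply/tensor_ofP; apply: teq_addC.
Qed.

Fact tensor_add0 : left_id (tens 0 0) tensor_add.
Proof.
elim/tensorW=> x; rewrite tensE tensor_addE.
by apply/tensor_ofP; apply: teq_add0.
Qed.

Fact tensor_addN : left_inverse (tens 0 0) (tensor_scale (-1)) tensor_add.
Proof.
elim/tensorW=> x; rewrite tensE tensor_scaleE tensor_addE.
by apply/tensor_ofP; apply: teq_addN.
Qed.

HB.instance Definition _ := GRing.isZmodule.Build tensor
  tensor_addA tensor_addC tensor_add0 tensor_addN.

Fact tensor_scaleA a b x :
  tensor_scale a (tensor_scale b x) = tensor_scale (a * b) x.
Proof.
elim/tensorW: x => x; rewrite !tensor_scaleE.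
by apply/tensor_ofP; apply: teq_scaleA.
Qed.

Fact tensor_scale1 : left_id 1 tensor_scale.
Proof.
by elim/tensorW=> x; rewrite tensor_scaleE; apply/tensor_ofP; apply: teq_scale1.
Qed.

Fact tensor_scaleDr : right_distributive tensor_scale +%R.
Proof.
move=> a; elim/tensorW=> x; elim/tensorW=> y.
rewrite [_ + _]tensor_addE !tensor_scaleE [RHS]tensor_addE.
by apply/tensor_ofP; apply: teq_scaleDr.
Qed.

Fact tensor_scaleDl x : {morph tensor_scale^~ x : a b / a + b}.
Proof.
move=> a b; elim/tensorW: x => x; rewrite !tensor_scaleE [RHS]tensor_addE.
by apply/tensor_ofP; apply: teq_scaleDl.
Qed.

HB.instance Definition _ := GRing.Zmodule_isLmodule.Build K tensor
  tensor_scaleA tensor_scale1 tensor_scaleDr tensor_scaleDl.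

Lemma tensDl v v' w : tens (v + v') w = tens v w + tens v' w.
Proof.
rewrite !tensE [RHS]tensor_addE.
by apply/tensor_ofP; apply: teq_pureDl.
Qed.

Lemma tensDr v w w' : tens v (w + w') = tens v w + tens v w'.
Proof.
rewrite !tensE [RHS]tensor_addE.
by apply/tensor_ofP; apply: teq_pureDr.
Qed.

Lemma tensZl a v w : tens (a *: v) w = a *: tens v w.
Proof.
rewrite !tensE [RHS]tensor_scaleE.
by apply/tensor_ofP; apply: teq_pureZl.
Qed.

Lemma tensZr a v w : tens v (a *: w) = a *: tens v w.
Proof.
rewrite !tensE [RHS]tensor_scaleE.
by apply/tensor_ofP; apply: teq_pureZr.
Qed.

Lemma tensor_ind (P : tensor -> Prop) :
  (forall v w, P (tens v w)) -> (forall x y, P x -> P y -> P (x + y)) ->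
  (forall c x, P x -> P (c *: x)) -> forall x, P x.
Proof.
move=> P1 P2 P3; elim/tensorW; elim=> [v w|x Px y Py|c x Px].
- by rewrite -tensE; apply: P1.
- by have := P2 _ _ Px Py; rewrite [_ + _]tensor_addE.
- by have := P3 c _ Px; rewrite [_ *: _]tensor_scaleE.
Qed.

Section Lift.
Variables (X : lmodType K) (f : V -> W -> X).

Fixpoint teval (t : tterm) : X :=
  match t with
  | TPure v w => f v w
  | TAdd x y => teval x + teval y
  | TScale c x => c *: teval x
  end.

Definition tensor_lift (x : tensor) : X := teval (tensor_repr x).

Hypotheses (fl : forall w, linear (f^~ w)) (fr : forall v, linear (f v)).

Let f0 v : f v 0 = 0.
Proof.
have := fr v (-1) 0 0.
by rewrite scaler0 addr0 scaleN1r addNr.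
Qed.

Let f0l w : f 0 w = 0.
Proof.
have := fl w (-1) 0 0.
by rewrite scaler0 addr0 scaleN1r addNr.
Qed.

Lemma teval_eq x y : teq x y -> teval x = teval y.
Proof.
elim=> {x y} //=.
- by move=> x y z _ -> _ ->.
- by move=> x x' y y' _ -> _ ->.
- by move=> c x x' _ ->.
- by move=> x y z; rewrite addrA.
- by move=> x y; rewrite addrC.
- by move=> x; rewrite f0 add0r.
- by move=> x; rewrite f0 scaleN1r addNr.
- by move=> a b x; rewrite scalerA.
- by move=> x; rewrite scale1r.
- by move=> a x y; rewrite scalerDr.
- by move=> a b x; rewrite scalerDl.
- by move=> v v' w; have := fl w 1 v v'; rewrite !scale1r.
- by move=> v w w'; have := fr v 1 w w'; rewrite !scale1r.
- by move=> a v w; have := fl w a v 0; rewrite f0l !addr0.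
- by move=> a v w; have := fr v a w 0; rewrite f0 !addr0.
Qed.

Lemma tensor_lift_of x : tensor_lift (tensor_of x) = teval x.
Proof. by apply: teval_eq; apply: repr_tensor_of. Qed.

Lemma tensor_lift_tens v w : tensor_lift (tens v w) = f v w.
Proof. by rewrite tensE tensor_lift_of. Qed.

Lemma tensor_lift_linear : linear tensor_lift.
Proof.
move=> a; elim/tensorW=> x; elim/tensorW=> y.
by rewrite [_ *: _]tensor_scaleE [_ + _]tensor_addE !tensor_lift_of.
Qed.

End Lift.
End Tensor.

(* [U(L)] is the associative unital algebra generated by [L] subject to
   linearity of [L -> U(L)] and [[x, y] = x y - y x]: formal expressions
   modulo the least congruence containing the algebra axioms and these
   relations. *)

Section Envelope.
Variables (K : fieldType) (L : lieType K).

Inductive uterm : Type :=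
  | UScal of K
  | UGen of L
  | UAdd of uterm & uterm
  | UMul of uterm & uterm.

Inductive ueq : uterm -> uterm -> Prop :=
  | ueq_refl x : ueq x x
  | ueq_sym x y : ueq x y -> ueq y x
  | ueq_trans y x z : ueq x y -> ueq y z -> ueq x z
  | ueq_add x x' y y' : ueq x x' -> ueq y y' -> ueq (UAdd x y) (UAdd x' y')
  | ueq_mul x x' y y' : ueq x x' -> ueq y y' -> ueq (UMul x y) (UMul x' y')
  | ueq_addA x y z : ueq (UAdd x (UAdd y z)) (UAdd (UAdd x y) z)
  | ueq_addC x y : ueq (UAdd x y) (UAdd y x)
  | ueq_add0 x : ueq (UAdd (UScal 0) x) x
  | ueq_addN x : ueq (UAdd (UMul (UScal (-1)) x) x) (UScal 0)
  | ueq_mulA x y z : ueq (UMul x (UMul y z)) (UMul (UMul x y) z)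
  | ueq_mul1 x : ueq (UMul (UScal 1) x) x
  | ueq_mulDl x y z : ueq (UMul (UAdd x y) z) (UAdd (UMul x z) (UMul y z))
  | ueq_mulDr x y z : ueq (UMul x (UAdd y z)) (UAdd (UMul x y) (UMul x z))
  | ueq_scalC a x : ueq (UMul (UScal a) x) (UMul x (UScal a))
  | ueq_scalD a b : ueq (UScal (a + b)) (UAdd (UScal a) (UScal b))
  | ueq_scalM a b : ueq (UScal (a * b)) (UMul (UScal a) (UScal b))
  | ueq_genD x y : ueq (UGen (x + y)) (UAdd (UGen x) (UGen y))
  | ueq_genZ a x : ueq (UGen (a *: x)) (UMul (UScal a) (UGen x))
  | ueq_lie x y : ueq (UAdd (UGen (lie x y)) (UMul (UGen y) (UGen x)))
                      (UMul (UGen x) (UGen y)).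

HB.instance Definition _ := gen_eqMixin uterm.
HB.instance Definition _ := gen_choiceMixin uterm.

Definition ueqb (x y : uterm) : bool := `[< ueq x y >].

Fact ueqb_refl : reflexive ueqb.
Proof. by move=> x; apply/asboolP; apply: ueq_refl. Qed.

Fact ueqb_sym : symmetric ueqb.
Proof. by move=> x y; apply/asboolP/asboolP; apply: ueq_sym. Qed.

Fact ueqb_trans : transitive ueqb.
Proof.
move=> y x z /asboolP xy /asboolP yz.
by apply/asboolP; apply: ueq_trans xy yz.
Qed.

Canonical ueqb_equiv := EquivRel ueqb ueqb_refl ueqb_sym ueqb_trans.

Definition envelope : Type := {eq_quot ueqb}.
HB.instance Definition _ := Choice.on envelope.

Definition envelope_of (x : uterm) : envelope := \pi_({eq_quot ueqb}) x.
Definition envelope_repr (x : envelope) : uterm := repr (x : {eq_quot ueqb}).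

Lemma envelope_reprK : cancel envelope_repr envelope_of.
Proof. by move=> x; rewrite /envelope_of /envelope_repr reprK. Qed.

Lemma envelope_ofP x y : envelope_of x = envelope_of y <-> ueq x y.
Proof.
split=> [/eqmodP/asboolP //|xy].
by apply/eqmodP/asboolP.
Qed.

Lemma repr_envelope_of x : ueq (envelope_repr (envelope_of x)) x.
Proof. by apply/envelope_ofP; rewrite envelope_reprK. Qed.

Lemma envelopeW (P : envelope -> Prop) :
  (forall x, P (envelope_of x)) -> forall x, P x.
Proof. by move=> h x; rewrite -(envelope_reprK x). Qed.

Definition env_scal (c : K) : envelope := envelope_of (UScal c).
Definition env_gen (x : L) : envelope := envelope_of (UGen x).
Definition env_add : envelope -> envelope -> envelope :=
  locked (fun x y => envelope_of (UAdd (envelope_repr x) (envelope_repr y))).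
Definition env_mul : envelope -> envelope -> envelope :=
  locked (fun x y => envelope_of (UMul (envelope_repr x) (envelope_repr y))).
Definition env_opp (x : envelope) : envelope := env_mul (env_scal (-1)) x.
Definition env_scale (c : K) (x : envelope) : envelope :=
  env_mul (env_scal c) x.

Lemma env_addE x y :
  env_add (envelope_of x) (envelope_of y) = envelope_of (UAdd x y).
Proof.
rewrite /env_add -lock.
by apply/envelope_ofP; apply: ueq_add; apply: repr_envelope_of.
Qed.

Lemma env_mulE x y :
  env_mul (envelope_of x) (envelope_of y) = envelope_of (UMul x y).
Proof.
rewrite /env_mul -lock.
by apply/envelope_ofP; apply: ueq_mul; apply: repr_envelope_of.
Qed.

Fact env_addA : associative env_add.
Proof.
elim/envelopeW=> x; elim/envelopeW=> y; elim/envelopeW=> z.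
by rewrite !env_addE; apply/envelope_ofP; apply: ueq_addA.
Qed.

Fact env_addC : commutative env_add.
Proof.
elim/envelopeW=> x; elim/envelopeW=> y.
by rewrite !env_addE; apply/envelope_ofP; apply: ueq_addC.
Qed.

Fact env_add0 : left_id (env_scal 0) env_add.
Proof.
by elim/envelopeW=> x; rewrite env_addE; apply/envelope_ofP; apply: ueq_add0.
Qed.

Fact env_addN : left_inverse (env_scal 0) env_opp env_add.
Proof.
elim/envelopeW=> x; rewrite /env_opp env_mulE env_addE.
by apply/envelope_ofP; apply: ueq_addN.
Qed.

HB.instance Definition _ := GRing.isZmodule.Build envelope
  env_addA env_addC env_add0 env_addN.

Fact env_mulA : associative env_mul.
Proof.
elim/envelopeW=> x; elim/envelopeW=> y; elim/envelopeW=> z.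
by rewrite !env_mulE; apply/envelope_ofP; apply: ueq_mulA.
Qed.

Fact env_mul1 : left_id (env_scal 1) env_mul.
Proof.
by elim/envelopeW=> x; rewrite env_mulE; apply/envelope_ofP; apply: ueq_mul1.
Qed.

Fact env_scalC a x : env_mul (env_scal a) x = env_mul x (env_scal a).
Proof.
elim/envelopeW: x => x.
by rewrite !env_mulE; apply/envelope_ofP; apply: ueq_scalC.
Qed.

Fact env_mulr1 : right_id (env_scal 1) env_mul.
Proof. by move=> x; rewrite -env_scalC env_mul1. Qed.

Fact env_mulDl : left_distributive env_mul +%R.
Proof.
elim/envelopeW=> x; elim/envelopeW=> y; elim/envelopeW=> z.
rewrite [_ + _]env_addE !env_mulE [RHS]env_addE.
by apply/envelope_ofP; apply: ueq_mulDl.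
Qed.

Fact env_mulDr : right_distributive env_mul +%R.
Proof.
elim/envelopeW=> x; elim/envelopeW=> y; elim/envelopeW=> z.
rewrite [_ + _]env_addE !env_mulE [RHS]env_addE.
by apply/envelope_ofP; apply: ueq_mulDr.
Qed.

Section Eval.
Variables (B : algType K) (f : L -> B).

Fixpoint ueval (t : uterm) : B :=
  match t with
  | UScal c => c%:A
  | UGen x => f x
  | UAdd x y => ueval x + ueval y
  | UMul x y => ueval x * ueval y
  end.

Definition envelope_lift (x : envelope) : B := ueval (envelope_repr x).

Hypotheses (flin : linear f)
  (flie : forall x y, f (lie x y) = f x * f y - f y * f x).

Lemma ueval_eq x y : ueq x y -> ueval x = ueval y.
Proof.
have f0 : f 0 = 0.
  by have := flin (-1) 0 0; rewrite scaler0 addr0 scaleN1r addNr.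
elim=> {x y} //=.
- by move=> x y z _ -> _ ->.
- by move=> x x' y y' _ -> _ ->.
- by move=> x x' y y' _ -> _ ->.
- by move=> x y z; rewrite addrA.
- by move=> x y; rewrite addrC.
- by move=> x; rewrite scale0r add0r.
- by move=> x; rewrite scale0r scaleN1r mulN1r addNr.
- by move=> x y z; rewrite mulrA.
- by move=> x; rewrite scale1r mul1r.
- by move=> x y z; rewrite mulrDl.
- by move=> x y z; rewrite mulrDr.
- by move=> a x; rewrite mulr_algl mulr_algr.
- by move=> a b; rewrite scalerDl.
- by move=> a b; rewrite mulr_algl scalerA.
- by move=> x y; have := flin 1 x y; rewrite !scale1r.
- by move=> a x; have := flin a x 0; rewrite f0 !addr0 mulr_algl.
- by move=> x y; rewrite flie subrK.
Qed.

Lemma envelope_lift_of x : envelope_lift (envelope_of x) = ueval x.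
Proof. by apply: ueval_eq; apply: repr_envelope_of. Qed.

End Eval.

Fact env_oner_neq0 : env_scal 1 != env_scal 0.
Proof.
pose z (_ : L) : K^o := 0.
have zlin : linear z by move=> a x y; rewrite scaler0 addr0.
have zlie x y : z (lie x y) = z x * z y - z y * z x by rewrite subrr.
apply/eqP => /(congr1 (envelope_lift z)).
rewrite /env_scal !(envelope_lift_of zlin zlie) /=.
by rewrite scale1r scale0r => /eqP; rewrite oner_eq0.
Qed.

HB.instance Definition _ := GRing.Zmodule_isNzRing.Build envelope
  env_mulA env_mul1 env_mulr1 env_mulDl env_mulDr env_oner_neq0.

Fact env_scaleA a b x : env_scale a (env_scale b x) = env_scale (a * b) x.
Proof.
rewrite /env_scale env_mulA; congr env_mul.
by rewrite /env_scal env_mulE; apply/esym/envelope_ofP; apply: ueq_scalM.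
Qed.

Fact env_scaleDr : right_distributive env_scale +%R.
Proof. by move=> a x y; apply: env_mulDr. Qed.

Fact env_scaleDl x : {morph env_scale^~ x : a b / a + b}.
Proof.
move=> a b; rewrite -[RHS]env_mulDl; congr env_mul.
by rewrite [RHS]env_addE; apply/envelope_ofP; apply: ueq_scalD.
Qed.

HB.instance Definition _ := GRing.Zmodule_isLmodule.Build K envelope
  env_scaleA env_mul1 env_scaleDr env_scaleDl.

Fact env_scaleAl a (x y : envelope) : a *: (x * y) = (a *: x) * y.
Proof. exact: env_mulA. Qed.

HB.instance Definition _ := GRing.Lmodule_isLalgebra.Build K envelope
  env_scaleAl.

Fact env_scaleAr a (x y : envelope) : a *: (x * y) = x * (a *: y).
Proof.
rewrite [LHS]env_mulA [RHS]env_mulA; congr env_mul; exact: env_scalC.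
Qed.

HB.instance Definition _ := GRing.Lalgebra_isAlgebra.Build K envelope
  env_scaleAr.

Lemma env_gen_linear : linear env_gen.
Proof.
move=> a x y; rewrite [_ *: env_gen x]env_mulE [RHS]env_addE.
apply/envelope_ofP; apply: ueq_trans (ueq_genD _ _) _.
by apply: ueq_add (ueq_genZ _ _) (ueq_refl _).
Qed.

Lemma env_gen_lie x y :
  env_gen (lie x y) = env_gen x * env_gen y - env_gen y * env_gen x.
Proof.
apply: (addIr (env_gen y * env_gen x)); rewrite subrK.
rewrite ![_ * _]env_mulE [LHS]env_addE.
by apply/envelope_ofP; apply: ueq_lie.
Qed.

Section Lift.
Variables (B : algType K) (f : L -> B).
Hypotheses (flin : linear f)
  (flie : forall x y, f (lie x y) = f x * f y - f y * f x).

Lemma envelope_lift_gen x : envelope_lift f (env_gen x) = f x.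
Proof. exact: envelope_lift_of. Qed.

Lemma envelope_lift_linear : linear (envelope_lift f).
Proof.
move=> a; elim/envelopeW=> x; elim/envelopeW=> y.
by rewrite [_ *: _]env_mulE [_ + _]env_addE !envelope_lift_of //= mulr_algl.
Qed.

Lemma envelope_lift_monoid : monoid_morphism (envelope_lift f).
Proof.
split; first by rewrite [1]/(envelope_of _) envelope_lift_of //= scale1r.
elim/envelopeW=> x; elim/envelopeW=> y.
by rewrite [_ * _]env_mulE !envelope_lift_of.
Qed.

Lemma envelope_lift_unique (phi : {lrmorphism envelope -> B}) :
  (forall x, phi (env_gen x) = f x) -> phi =1 envelope_lift f.
Proof.
move=> phif; elim/envelopeW=> t; rewrite envelope_lift_of //.
elim: t => [c|x|x IHx y IHy|x IHx y IHy] /=.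
- have -> : envelope_of (UScal c) = c%:A by rewrite [RHS]env_mulr1.
  by rewrite linearZ rmorph1.
- exact: phif.
- have -> : envelope_of (UAdd x y) = envelope_of x + envelope_of y.
    by rewrite [RHS]env_addE.
  by rewrite rmorphD /= IHx IHy.
- have -> : envelope_of (UMul x y) = envelope_of x * envelope_of y.
    by rewrite [RHS]env_mulE.
  by rewrite rmorphM /= IHx IHy.
Qed.

End Lift.
End Envelope.

(* {malg K[M]} only has a product when M has no invertible elements but 1, so
   the group algebra of Z^n gets its own, on top of the vector space
   {malg K[Z^n]} of finitely supported functions on Z^n, where the function
   supported at m with value x stands for x t^m. *)

Notation expo n := {ffun 'I_n -> int}.

Definition laurent (K : fieldType) (n : nat) : Type := {malg K[expo n]}.

Section Laurent.
Variables (K : fieldType) (n : nat).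
Implicit Types (a b c : laurent K n) (m k : expo n).

HB.instance Definition _ := GRing.Lmodule.on (laurent K n).

Definition lcoef : expo n -> laurent K n -> K :=
  locked (fun m (a : {malg K[expo n]}) => mcoeff m a).

Definition lterm : K -> expo n -> laurent K n :=
  locked (fun x m => mkmalgU m x : {malg K[expo n]}).

Definition lmon m : laurent K n := lterm 1 m.

Definition lmul : laurent K n -> laurent K n -> laurent K n :=
  locked (fun a b => \sum_(k1 <- msupp a) \sum_(k2 <- msupp b)
    lterm (lcoef k1 a * lcoef k2 b) (k1 + k2)).

Lemma lcoefE m a : lcoef m a = mcoeff m (a : {malg K[expo n]}).
Proof. by rewrite /lcoef -lock. Qed.

Lemma ltermE (x : K) m : lterm x m = mkmalgU m x.
Proof. by rewrite /lterm -lock. Qed.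

Lemma lterm0 m : lterm 0 m = 0.
Proof. by rewrite ltermE; apply: monalgU0. Qed.

Lemma ltermD m (x y : K) : lterm (x + y) m = lterm x m + lterm y m.
Proof. by rewrite !ltermE; apply: monalgUD. Qed.

Lemma lcoef_lterm m (x : K) k : lcoef k (lterm x m) = x *+ (m == k).
Proof. by rewrite lcoefE ltermE; apply: mcoeffU. Qed.

Lemma lcoefP a b : (forall m, lcoef m a = lcoef m b) -> a = b.
Proof. by move=> ab; apply/malgP => m; rewrite -!lcoefE. Qed.

Lemma lcoef_linear m : linear_for *%R (lcoef m).
Proof. by move=> x a b; rewrite !lcoefE mcoeffD mcoeffZ. Qed.

HB.instance Definition _ m :=
  GRing.isLinear.Build K (laurent K n) K *%R (lcoef m) (lcoef_linear m).

Lemma laurentE a : a = \sum_(m <- msupp a) lterm (lcoef m a) m.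
Proof.
rewrite {1}[a]monalgE; apply: eq_bigr => m _.
by rewrite lcoefE ltermE.
Qed.

Lemma lcoef_out m a : m \notin msupp a -> lcoef m a = 0.
Proof. by rewrite lcoefE; apply: mcoeff_outdom. Qed.

Lemma msupp_lterm (x : K) m : (msupp (lterm x m) `<=` [fset m])%fset.
Proof. by rewrite ltermE; apply: msuppU_le. Qed.

Lemma lmulw (d1 d2 : {fset (expo n)}) a b :
  (msupp a `<=` d1)%fset -> (msupp b `<=` d2)%fset ->
  lmul a b = \sum_(k1 <- d1) \sum_(k2 <- d2)
    lterm (lcoef k1 a * lcoef k2 b) (k1 + k2).
Proof.
move=> le1 le2; rewrite /lmul -lock (big_fset_incl _ le1) /=.
  apply/eq_bigr=> k1 _; apply/big_fset_incl => // k _ /lcoef_out ->.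
  by rewrite mulr0 lterm0.
move=> k _ /lcoef_out ak.
by rewrite big1 // => k' _; rewrite ak mul0r lterm0.
Qed.

Fact lmulC : commutative lmul.
Proof.
move=> a b; rewrite /lmul -lock exchange_big /=.
by apply/eq_bigr=> k1 _; apply/eq_bigr=> k2 _; rewrite mulrC addrC.
Qed.

Fact lmulDl : left_distributive lmul +%R.
Proof.
move=> a b c.
rewrite [lmul a c](lmulw (fsubsetUl _ (msupp b)) (fsubset_refl _)).
rewrite [lmul b c](lmulw (fsubsetUr (msupp a) _) (fsubset_refl _)).
rewrite [lmul (a + b) c](lmulw (msuppD_le _ _) (fsubset_refl _)).
rewrite -big_split /=; apply/eq_bigr=> k1 _.
rewrite -big_split /=; apply/eq_bigr=> k2 _.
by rewrite linearD mulrDl ltermD.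
Qed.

Lemma lmulDr : right_distributive lmul +%R.
Proof. by move=> a b c; rewrite lmulC lmulDl ![lmul _ a]lmulC. Qed.

Lemma lmul0l : left_zero 0 lmul.
Proof. by move=> a; rewrite /lmul -lock msupp0 big_seq_fset0. Qed.

Lemma lmul0r : right_zero 0 lmul.
Proof. by move=> a; rewrite lmulC lmul0l. Qed.

Lemma lmul_lterm x y k1 k2 :
  lmul (lterm x k1) (lterm y k2) = lterm (x * y) (k1 + k2).
Proof.
rewrite (lmulw (msupp_lterm _ _) (msupp_lterm _ _)) !big_seq_fset1.
by rewrite !lcoef_lterm !eqxx !mulr1n.
Qed.

Lemma laurent_ind (P : laurent K n -> Prop) :
  P 0 -> (forall a b, P a -> P b -> P (a + b)) ->
  (forall x m, P (lterm x m)) -> forall a, P a.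
Proof.
by move=> P0 PD PU a; rewrite [a]laurentE; apply: big_ind => // i _; apply: PU.
Qed.

Fact lmulA : associative lmul.
Proof.
elim/laurent_ind=> [||x k1] b c; first by rewrite !lmul0l.
  by move=> IHb IHc u v; rewrite !lmulDl IHb IHc.
elim/laurent_ind: b c => [||y k2] b; first by rewrite !(lmul0l, lmul0r).
  by move=> c IHb IHc u; rewrite !(lmulDl, lmulDr) IHb IHc.
elim/laurent_ind: b => [||z k3]; first by rewrite !lmul0r.
  by move=> b c IHb IHc; rewrite !lmulDr IHb IHc.
by rewrite !lmul_lterm mulrA addrA.
Qed.

Fact lmul1 : left_id (lmon 0) lmul.
Proof.
elim/laurent_ind=> [|a b IHa IHb|x m]; first by rewrite lmul0r.
  by rewrite lmulDr IHa IHb.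
by rewrite lmul_lterm mul1r add0r.
Qed.

Fact lmon0_neq0 : lmon 0 != 0.
Proof.
apply/eqP=> /(congr1 (lcoef 0)) /eqP.
by rewrite lcoef_lterm eqxx linear0 oner_eq0.
Qed.

HB.instance Definition _ := GRing.Zmodule_isComNzRing.Build (laurent K n)
  lmulA lmulC lmul1 lmulDl lmon0_neq0.

Fact lscaleAl (x : K) a b : x *: (a * b) = (x *: a) * b.
Proof.
have Z y m : x *: lterm y m = lterm (x * y) m.
  by apply: lcoefP => k; rewrite linearZ /= !lcoef_lterm mulrnAr.
elim/laurent_ind: a => [|a c IHa IHc|y m]; first by rewrite mul0r scaler0 mul0r.
  by rewrite mulrDl !scalerDr mulrDl IHa IHc.
elim/laurent_ind: b => [|a c IHa IHc|z k]; first by rewrite !mulr0 scaler0.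
  by rewrite !mulrDr scalerDr IHa IHc.
by rewrite Z ![_ * lterm _ _]lmul_lterm Z mulrA.
Qed.

HB.instance Definition _ := GRing.Lmodule_isLalgebra.Build K (laurent K n)
  lscaleAl.
HB.instance Definition _ := GRing.Lalgebra_isComAlgebra.Build K (laurent K n).

Lemma lmonD m k : lmon (m + k) = lmon m * lmon k.
Proof. by rewrite [RHS]lmul_lterm mulr1. Qed.

Definition lvar_pow (i : 'I_n) (z : int) : laurent K n :=
  lmon [ffun j => if j == i then z else 0].

(* The subalgebra C[t_1^{+-r_1}, ..., t_n^{+-r_n}] is generated by the t_i^{r_i}
   and their inverses. *)
Definition laurent_sub (r : 'I_n -> nat) : set (laurent K n) :=
  smallest (@is_subalgebra K (laurent K n))
    [set a | exists i, a = lvar_pow i (r i)%:Z \/ a = lvar_pow i (- (r i)%:Z)].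

End Laurent.

Section Apsi.
Variables (K : fieldType) (V : lmodType K) (n : nat).
Local Notation A := (laurent K n).
Variable psi : {scalar (tensor V A)}.

Definition psi_fun (h : V) (m : expo n) : K := psi (tens h (lmon K m)).

(* The bilinear map underlying psibar, (h, t^m) |-> psi(h (x) t^m) t^m; see
   [psibar_tens]. *)
Definition psibar_bil : V -> A -> A := locked (fun h a =>
  \sum_(m <- msupp a) lcoef m a *: (psi_fun h m *: lmon K m)).

Lemma lcoef_psibar_bil h a m :
  lcoef m (psibar_bil h a) = lcoef m a * psi_fun h m.
Proof.
rewrite /psibar_bil -lock linear_sum /=.
under eq_bigr => k _ do rewrite !linearZ /= lcoef_lterm.
have [ms|/lcoef_out ms] := boolP (m \in msupp a); last first.
  rewrite ms mul0r big1_fset // => k ka _.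
  have [km|] := eqVneq k m; last by rewrite !mulr0.
  by rewrite km ms mul0r.
rewrite (big_fsetD1 m) //= eqxx mulr1 big1_fset ?addr0 // => k.
by rewrite in_fsetD1 => /andP[/negbTE -> _] _; rewrite !mulr0.
Qed.

Lemma psibar_bil_linearl a : linear (psibar_bil^~ a).
Proof.
move=> x h h'; apply: lcoefP => m.
rewrite linearP /= !lcoef_psibar_bil /psi_fun tensDl tensZl linearP /=.
by rewrite mulrDr mulrCA.
Qed.

Lemma psibar_bil_linearr h : linear (psibar_bil h).
Proof.
move=> x a b; apply: lcoefP => m.
rewrite (linearP (lcoef m)) /= !lcoef_psibar_bil (linearP (lcoef m)) /=.
by rewrite mulrDl mulrA.
Qed.

Definition psibar : tensor V A -> A := tensor_lift psibar_bil.

HB.instance Definition _ := GRing.isLinear.Build K (tensor V A) A *:%R psibar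
  (tensor_lift_linear psibar_bil_linearl psibar_bil_linearr).

Lemma psibar_tens h m :
  psibar (tens h (lmon K m)) = psi (tens h (lmon K m)) *: lmon K m.
Proof.
rewrite /psibar tensor_lift_tens; last 2 first.
- exact: psibar_bil_linearl.
- exact: psibar_bil_linearr.
apply: lcoefP => k; rewrite lcoef_psibar_bil linearZ /= !lcoef_lterm.
by case: eqVneq => [->|_]; rewrite ?mulr1 ?mul1r // mul0r mulr0.
Qed.

Local Notation U := (envelope (abelian_lie (tensor V A))).

Definition psihat : U -> A := envelope_lift (psibar : abelian_lie (tensor V A) -> A).

Let psibar_lin : linear (psibar : abelian_lie (tensor V A) -> A).
Proof. exact: linearP. Qed.

Let psibar_lie (x y : abelian_lie (tensor V A)) :
  psibar (lie x y) = psibar x * psibar y - psibar y * psibar x.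
Proof. by rewrite [psibar y * _]mulrC subrr [LHS]linear0. Qed.

HB.instance Definition _ := GRing.isLinear.Build K U A *:%R psihat
  (envelope_lift_linear psibar_lin psibar_lie).
HB.instance Definition _ := GRing.isMonoidMorphism.Build U A psihat
  (envelope_lift_monoid psibar_lin psibar_lie).

Lemma psihat_gen (x : abelian_lie (tensor V A)) : psihat (env_gen x) = psibar x.
Proof. exact: (envelope_lift_gen psibar_lin psibar_lie). Qed.

Definition A_psi : set A := range psihat.

End Apsi.

Section ExpPoly.
Variables (K : fieldType) (n : nat).
Local Notation torus := {ffun 'I_n -> K}.

Definition in_torus (lam : torus) : Prop := forall i, lam i != 0.

Definition int_monomial (l : {ffun 'I_n -> nat}) (m : expo n) : K :=
  \prod_(i < n) (m i)%:~R ^+ l i.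

Definition exp_fun (lam : torus) (m : expo n) : K := \prod_(i < n) lam i ^ m i.

Definition is_polyfun (p : expo n -> K) : Prop :=
  exists (s : seq {ffun 'I_n -> nat}) (C : {ffun 'I_n -> nat} -> K),
    forall m, p m = \sum_(l <- s) C l * int_monomial l m.

Definition is_exp_poly (f : expo n -> K) : Prop :=
  exists (s : seq ({ffun 'I_n -> nat} * torus))
         (C : {ffun 'I_n -> nat} -> torus -> K),
    (forall x, x \in s -> in_torus x.2) /\
    forall m, f m =
      \sum_(x <- s) C x.1 x.2 * int_monomial x.1 m * exp_fun x.2 m.

Section Twist.
Variables (r : 'I_n -> nat) (xi : 'I_n -> K).

(* Z/r_1 x ... x Z/r_n, with residue classes represented by 0, ..., r_i - 1 *)
Definition Gammabar := {dffun forall i : 'I_n, 'I_(r i)}.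

Definition gact (k : Gammabar) (lam : torus) : torus :=
  [ffun i => xi i ^+ k i * lam i].

Definition orbit_representatives (B : set torus) : Prop :=
  B `<=` in_torus /\
  forall lam, in_torus lam ->
    exists! b, B b /\ exists k : Gammabar, lam = gact k b.

(* Given by multiplication with a character of Z^n, which makes sense on all
   functions; [Tk_exp] is the defining property on exp-polynomial maps. *)
Definition Tk (k : Gammabar) (f : expo n -> K) (m : expo n) : K :=
  (\prod_(i < n) xi i ^ ((k i)%:Z * m i)) * f m.

Definition P_R (f : expo n -> K) (m : expo n) : K :=
  \sum_(k : Gammabar) Tk k f m.

Lemma Tk_exp (k : Gammabar) (p : expo n -> K) (lam : torus) m :
  Tk k (fun m => p m * exp_fun lam m) m = p m * exp_fun (gact k lam) m.
Proof.
rewrite /Tk /exp_fun mulrCA -big_split /=; congr (_ * _).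
by apply: eq_bigr => i _; rewrite ffunE expfzMl exprnP exprz_exp.
Qed.

End Twist.
End ExpPoly.

(* Main.v *)
Require Import Defs.
From HB Require Import structures.
From mathcomp Require Import all_boot all_order all_algebra complex.
From mathcomp Require Import boolp classical_sets reals.

Set Implicit Arguments.
Unset Strict Implicit.
Unset Printing Implicit Defensive.

Import GRing.Theory Num.Theory.

Local Open Scope ring_scope.
Local Open Scope classical_set_scope.

(** Put f = psi_h.  Since psibar (h (x) t^m) = f(m) t^m lies in A_psi, which
    consists of Laurent polynomials with exponents in the lattice
    r_1 Z x ... x r_n Z, the function f vanishes off this lattice.

    The operator T_k is multiplication by the character
    chi_k(m) = xi_1^(k_1 m_1) ... xi_n^(k_n m_n), so P_R is multiplication by
    the sum of all chi_k.  As xi_i is a primitive r_i-th root of unity, the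
    lattice is the common kernel of these characters.  On it the sum of the
    chi_k is the number N of characters, and off it the sum is 0 by
    orthogonality ([P_R_on_kernel] and [P_R_off_kernel]).  Hence P_R g = f as
    soon as N g agrees with f on the lattice.

    Finally, if lambda = k . b then exp lambda = chi_k exp b, so exp lambda and
    exp b agree on the lattice ([exp_fun_gact]).  Replacing every lambda in an
    exp-polynomial expression of f by the representative of its orbit, dividing
    by N, and collecting the terms with the same representative gives the
    required g. *)

(** * Laurent polynomials with exponents in a submonoid of Z^n *)

Section Support.
Variables (K : fieldType) (n : nat).

(** Closure under products is the grading of the Laurent polynomials: every
    exponent of a b is the sum of an exponent of a and an exponent of b. *)
Lemma supported_subalgebra (L : set (expo n)) :
  L 0 -> (forall k m, L k -> L m -> L (k + m)) ->
  is_subalgebra [set a : laurent K n | forall m, lcoef m a != 0 -> L m].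
Proof.
move=> L0 LD.
have Lout (a : laurent K n) m : (forall k, lcoef k a != 0 -> L k) ->
    ~ L m -> lcoef m a = 0.
  by move=> La nL; apply: contra_notP nL => /eqP; apply: La.
split=> [|m|a b La Lb m].
- split=> [m|x a b La Lb m]; first by rewrite linear0 eqxx.
  apply: contra_neqP => nL.
  by rewrite linearP /= (Lout a) // (Lout b) // mulr0 addr0.
- rewrite (_ : 1 = lterm 1 0) // lcoef_lterm.
  by have [<-|] := eqVneq 0 m; rewrite ?eqxx.
- apply: contra_neqP => nL.
  rewrite [a]laurentE [b]laurentE mulr_suml linear_sum big1 //= => k1 _.
  rewrite mulr_sumr linear_sum big1 //= => k2 _.
  rewrite [_ * _]lmul_lterm lcoef_lterm.
  have [km|_] := eqVneq (k1 + k2) m; last by rewrite mulr0n.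
  have [L1|/(Lout _ _ La)->] := pselect (L k1); last by rewrite mul0r.
  have [L2|/(Lout _ _ Lb)->] := pselect (L k2); last by rewrite mulr0.
  by case: nL; rewrite -km; apply: LD.
Qed.

End Support.

(** * The characters of Z^n attached to the roots of unity *)

Section Kernel.
Variables (K : fieldType) (n : nat) (r : 'I_n -> nat) (xi : 'I_n -> K).
Hypothesis xi_prim : forall i, (r i).-primitive_root (xi i).
Local Notation torus := {ffun 'I_n -> K}.

(** As xi_i has order r_i, this is the lattice of all m with r_i dividing m_i
    for every i; the multiplicative form is the one that character sums see. *)
Definition char_kernel (m : expo n) : Prop := forall i, xi i ^ m i = 1.

Lemma xi_neq0 i : xi i != 0.
Proof.
apply/eqP=> xi0; have := prim_expr_order (xi_prim i).
rewrite xi0 expr0n -[(r i == 0)%N]negbK -lt0n (prim_order_gt0 (xi_prim i)).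
by move/eqP; rewrite eq_sym oner_eq0.
Qed.

Lemma laurent_sub_supported (a : laurent K n) m :
  laurent_sub (K := K) r a -> lcoef m a != 0 -> char_kernel m.
Proof.
suff /smallest_sub sub :
    is_subalgebra [set a : laurent K n | forall m, lcoef m a != 0 ->
      char_kernel m].
  move=> ar; apply: (sub _ _ _ ar) => b [i bE] k.
  have xir : xi i ^ (r i)%:Z = 1 by exact: prim_expr_order.
  have lvar_char z : xi i ^ z = 1 -> lcoef k (lvar_pow K i z) != 0 ->
      char_kernel k.
    move=> xiz; rewrite lcoef_lterm.
    have [<- _ j|_] := eqVneq _ k; last by rewrite mulr0n eqxx.
    by rewrite ffunE; case: (eqVneq j i) => [->|_]; rewrite ?expr0z.
  by case: bE => ->; apply: lvar_char; rewrite // -invr_expz xir invr1.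
apply: supported_subalgebra => [i|k1 k2 L1 L2 i]; first by rewrite ffunE expr0z.
by rewrite ffunE expfzDr ?xi_neq0 // L1 L2 mulr1.
Qed.

Lemma Tk_on_kernel (k : Gammabar r) (f : expo n -> K) m :
  char_kernel m -> Tk xi k f m = f m.
Proof.
move=> Lm; rewrite /Tk big1 ?mul1r // => i _.
by rewrite mulrC -exprz_exp Lm exp1rz.
Qed.

Lemma P_R_on_kernel (f : expo n -> K) m :
  char_kernel m -> P_R r xi f m = #|{: Gammabar r}|%:R * f m.
Proof.
move=> Lm; rewrite /P_R (eq_bigr (fun=> f m)) => [|k _]; last first.
  exact: Tk_on_kernel.
by rewrite sumr_const mulr_natl.
Qed.

(** Orthogonality of characters: adding 1 to the i-th coordinate permutes the
    group and multiplies every summand by xi_i^(m_i), so the sum is zero when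
    this factor is not 1. *)
Lemma P_R_off_kernel (f : expo n -> K) m : ~ char_kernel m -> P_R r xi f m = 0.
Proof.
case/existsNP=> i /eqP xim.
pose shift (k : Gammabar r) : Gammabar r :=
  [ffun j => if j == i then ordS (k j) else k j].
have shift_inj : injective shift.
  move=> k1 k2 /ffunP k12; apply/ffunP=> j; have := k12 j.
  by rewrite !ffunE; case: ifP => // _ /ordS_inj.
have shiftE k : Tk xi (shift k) f m = xi i ^ m i * Tk xi k f m.
  rewrite /Tk mulrA; congr (_ * _).
  rewrite (bigD1 i) //= [in RHS](bigD1 i) //= mulrA; congr (_ * _).
    rewrite ffunE eqxx /= -!exprz_exp -exprnP.
    (* [ordS] wraps around at r_i, which xi_i does not notice *)
    rewrite (prim_expr_mod (xi_prim i)) exprS exprnP.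
    by rewrite expfzMl.
  by apply: eq_bigr => j /negbTE ji; rewrite ffunE ji.
have : P_R r xi f m = xi i ^ m i * P_R r xi f m.
  rewrite {1}/P_R (reindex_inj shift_inj) /= mulr_sumr.
  by apply: eq_bigr => k _; apply: shiftE.
move/eqP; rewrite -subr_eq0 -{1}[P_R _ _ _ _]mul1r -mulrBl mulf_eq0.
by rewrite subr_eq0 eq_sym (negbTE xim) => /eqP.
Qed.

Lemma exp_fun_gact (k : Gammabar r) (b : torus) m :
  char_kernel m -> exp_fun (gact xi k b) m = exp_fun b m.
Proof.
move=> Lm; rewrite /exp_fun; apply: eq_bigr => i _.
rewrite ffunE expfzMl exprnP exprz_exp [_%:Z * _]mulrC.
by rewrite -exprz_exp Lm exp1rz mul1r.
Qed.

End Kernel.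

(** * Collecting the terms of an exp-polynomial *)

Lemma big_fibers (V : nmodType) (I J : eqType) (g : I -> J) (s : seq I)
    (F : I -> V) :
  \sum_(x <- s) F x =
  \sum_(j <- undup (map g s)) \sum_(x <- s | g x == j) F x.
Proof.
rewrite (exchange_big_dep xpredT) //= big_seq [RHS]big_seq.
apply: eq_bigr => x xs; rewrite -big_filter.
under eq_filter do rewrite eq_sym.
by rewrite filter_pred1_uniq ?undup_uniq ?mem_undup ?map_f // big_seq1.
Qed.

(** The exponents [l x] may repeat, whereas [is_polyfun] attaches a coefficient
    to each exponent; hence the grouping by exponent. *)
Lemma polyfun_sum (K : fieldType) (n : nat) (I : eqType) (s : seq I)
    (D : I -> K) (l : I -> {ffun 'I_n -> nat}) :
  is_polyfun (fun m => \sum_(x <- s) D x * int_monomial K (l x) m).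
Proof.
exists (undup (map l s)), (fun l0 => \sum_(x <- s | l x == l0) D x) => m.
rewrite (big_fibers l); apply: eq_bigr => l0 _; rewrite mulr_suml.
by apply: eq_bigr => x /eqP->.
Qed.

(** Only the values on the kernel of the characters matter for both sides, and
    there the exponentials of a torus point and of the representative of its
    orbit coincide.  Characteristic zero makes the number of characters
    invertible. *)
Lemma exp_poly_eq_P_R (K : numFieldType) (n : nat) (r : 'I_n -> nat)
    (xi : 'I_n -> K) (B : set {ffun 'I_n -> K}) (f : expo n -> K) :
  (forall i, (r i).-primitive_root (xi i)) ->
  orbit_representatives r xi B -> is_exp_poly f ->
  (forall m, ~ char_kernel xi m -> f m = 0) ->
  exists (s : seq {ffun 'I_n -> K}) (p : {ffun 'I_n -> K} -> expo n -> K),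
    [/\ uniq s, forall lam, lam \in s -> B lam,
        forall lam, lam \in s -> is_polyfun (p lam)
      & f = P_R r xi (fun m => \sum_(lam <- s) p lam m * exp_fun lam m)].
Proof.
move=> xi_prim [_ B_repr] [sf [C [sf_torus fE]]] f_off.
have /choice[rep repP] (lam : {ffun 'I_n -> K}) : exists b,
    in_torus lam -> B b /\ exists k : Gammabar r, lam = gact xi k b.
  have [/B_repr[b [bP _]]|nlam] := pselect (in_torus lam); first by exists b.
  (* arbitrary value off the torus *)
  by exists lam.
pose N : K := #|{: Gammabar r}|%:R.
have N_neq0 : N != 0.
  rewrite pnatr_eq0 -lt0n; apply/card_gt0P.
  by exists [ffun i => Ordinal (prim_order_gt0 (xi_prim i))].
pose p lam m : K := \sum_(x <- sf | rep x.2 == lam)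
  C x.1 x.2 / N * int_monomial K x.1 m.
exists (undup [seq rep x.2 | x <- sf]), p; split=> [|lam|lam _|].
- exact: undup_uniq.
- by rewrite mem_undup => /mapP[x /sf_torus/repP[Bx _] ->].
- rewrite (_ : p lam = fun m => \sum_(x <- [seq x <- sf | rep x.2 == lam])
      C x.1 x.2 / N * int_monomial K x.1 m); first exact: polyfun_sum.
  by apply: funext => m; rewrite big_filter.
apply: funext => m; have [Lm|nLm] := pselect (char_kernel xi m); last first.
  by rewrite P_R_off_kernel // f_off.
rewrite P_R_on_kernel // -/N.
pose F x := C x.1 x.2 / N * int_monomial K x.1 m * exp_fun (rep x.2) m.
transitivity (N * \sum_(x <- sf) F x); last first.
  rewrite (big_fibers (fun x => rep x.2)); congr (_ * _).
  apply: eq_bigr => lam _; rewrite mulr_suml.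
  by apply: eq_bigr => x /eqP <-.
rewrite fE mulr_sumr big_seq [RHS]big_seq; apply: eq_bigr => x /sf_torus/repP.
case=> _ [k xk]; rewrite /F {2}xk exp_fun_gact // !mulrA.
by rewrite [N * _]mulrC mulfK.
Qed.

(** * The support of psi *)

Lemma psi_fun_A_psi (K : fieldType) (V : lmodType K) (n : nat)
    (psi : {scalar (tensor V (laurent K n))}) (h : V) (m : expo n) :
  A_psi psi (psi_fun psi h m *: lmon K m).
Proof.
pose x : abelian_lie (tensor V (laurent K n)) := tens h (lmon K m).
by exists (env_gen x); rewrite // psihat_gen psibar_tens.
Qed.

Theorem proposition3p4 (R : realType) (g : kac_moody R[i]) (n : nat)
    (r : 'I_n -> nat) (xi : 'I_n -> R[i]) (B : set {ffun 'I_n -> R[i]})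
    (psi : {scalar (tensor (hprime g) (laurent R[i] n))})
    (xi_prim : forall i, (r i).-primitive_root (xi i))
    (B_repr : orbit_representatives r xi B)
    (psi_exp : forall h : hprime g, is_exp_poly (psi_fun psi h))
    (r_gt0 : forall i, (0 < r i)%N)
    (r_ge2 : (2 <= \prod_(i < n) r i)%N)
    (psi_img : A_psi psi = laurent_sub r) :
  forall h : hprime g,
  exists (s : seq {ffun 'I_n -> R[i]})
         (p : {ffun 'I_n -> R[i]} -> expo n -> R[i]),
    [/\ uniq s, forall lam, lam \in s -> B lam,
        forall lam, lam \in s -> is_polyfun (p lam)
      & psi_fun psi h =
        P_R r xi (fun m => \sum_(lam <- s) p lam m * exp_fun lam m) ].
Proof.
move=> h; apply: exp_poly_eq_P_R => // m; apply: contra_notP => /eqP fm_neq0.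
have := psi_fun_A_psi psi h m; rewrite psi_img.
move=> /(laurent_sub_supported xi_prim); apply.
by rewrite linearZ /= lcoef_lterm eqxx mulr1.
Qed.
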